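(* Let $K$ be a field, $S=K[x_1,\ldots,x_n]$ the polynomial ring, and $I\subset S$ an ideal of Borel type, i.e. a monomial ideal such that $$I:x_j^\infty=I:(x_1,\ldots,x_j)^\infty\quad\text{for all } j=1,\ldots,n.$$ Then $S/I$ is pretty clean.
   Context: For an ideal $J$, $I:J^\infty=\bigcup_{k\ge 1}(I:J^k)$. A finitely generated module $M$ over a Noetherian ring $S$ is pretty clean if it has a filtration $0=M_0\subset M_1\subset\cdots\subset M_r=M$ by submodules with $M_i/M_{i-1}\cong S/P_i$, $P_i$ a prime ideal, for all $i$, such that for all $i<j$ with $P_i\subset P_j$ one has $P_i=P_j$. *)

(* Defs.v *)
From HB Require Import structures.
From mathcomp Require Import all_boot all_order all_algebra.
From mathcomp.multinomials Require Import mpoly.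

Set Implicit Arguments.
Unset Strict Implicit.
Unset Printing Implicit Defensive.

Import GRing.Theory.

Local Open Scope ring_scope.
Local Open Scope quotient_scope.

(* [Quotient.quot] only provides the additive group V / N; when N is a
   submodule of V, [quotmod N] is the same type with its module structure. *)
Section QuotientModule.

Variables (R : nzRingType) (V : lmodType R) (N : submodClosed V).

Definition submod_pred : {pred V} := N.

Fact submod_pred_zmod : zmod_closed submod_pred.
Proof. exact: GRing.submod_closedB (submodClosedP N). Qed.

HB.instance Definition _ := GRing.isZmodClosed.Build V submod_pred
  submod_pred_zmod.

Definition quotmod := Quotient.quot submod_pred.

HB.instance Definition _ := GRing.Zmodule.on quotmod.

Definition quotmod_pi (x : V) : quotmod := \pi x.

Definition quotmod_scale (a : R) (u : quotmod) : quotmod :=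
  quotmod_pi (a *: repr u).

Lemma quotmod_eqE (x y : V) :
  (quotmod_pi x == quotmod_pi y) = (x - y \in N).
Proof. by rewrite /quotmod_pi -Quotient.idealrBE. Qed.

Lemma quotmod_piK (u : quotmod) : quotmod_pi (repr u) = u.
Proof. exact: reprK. Qed.

Fact quotmod_pi_zmod : zmod_morphism quotmod_pi.
Proof. exact: pi_is_zmod_morphism. Qed.

HB.instance Definition _ := GRing.isZmodMorphism.Build V quotmod quotmod_pi
  quotmod_pi_zmod.

Lemma quotmod_piZ (a : R) (x : V) :
  quotmod_pi (a *: x) = quotmod_scale a (quotmod_pi x).
Proof.
apply/eqP; rewrite quotmod_eqE -scalerBr rpredZ //.
by rewrite -quotmod_eqE quotmod_piK.
Qed.

Fact quotmod_scalerA a b u :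
  quotmod_scale a (quotmod_scale b u) = quotmod_scale (a * b) u.
Proof. by rewrite -[u]quotmod_piK -!quotmod_piZ scalerA. Qed.

Fact quotmod_scale1r : left_id 1 quotmod_scale.
Proof. by move=> u; rewrite -[u]quotmod_piK -!quotmod_piZ scale1r. Qed.

Fact quotmod_scalerDr : right_distributive quotmod_scale +%R.
Proof.
move=> a u v; rewrite -[u]quotmod_piK -[v]quotmod_piK -raddfD -!quotmod_piZ.
by rewrite scalerDr raddfD.
Qed.

Fact quotmod_scalerDl u : {morph quotmod_scale^~ u : a b / a + b}.
Proof.
by move=> a b; rewrite -[u]quotmod_piK -!quotmod_piZ scalerDl raddfD.
Qed.

HB.instance Definition _ := GRing.Zmodule_isLmodule.Build R quotmod
  quotmod_scalerA quotmod_scale1r quotmod_scalerDr quotmod_scalerDl.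

Fact quotmod_pi_scalable : scalable quotmod_pi.
Proof. exact: quotmod_piZ. Qed.

HB.instance Definition _ := GRing.isScalable.Build R V quotmod *:%R quotmod_pi
  quotmod_pi_scalable.

End QuotientModule.

Section Submodule.

Variables (R : nzRingType) (V : lmodType R) (N : submodClosed V).

Definition submod := {x : V | x \in N}.

HB.instance Definition _ := SubChoice.on submod.
HB.instance Definition _ := [SubChoice_isSubLmodule of submod by <:].

End Submodule.

(* N viewed inside the module underlying N', i.e. the submodule N :&: N' *)
Section Subquotient.

Variables (R : nzRingType) (V : lmodType R) (N' N : submodClosed V).

Definition submod_in : {pred submod N'} := fun x => val x \in N.

Lemma submod_inE x : (x \in submod_in) = (val x \in N).
Proof. by []. Qed.

Fact submod_in_closed : submod_closed submod_in.
Proof.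
split=> [|a x y]; rewrite !submod_inE; first by rewrite raddf0 rpred0.
by move=> xN yN; rewrite linearP rpredD ?rpredZ.
Qed.

HB.instance Definition _ := GRing.isSubmodClosed.Build R (submod N')
  submod_in submod_in_closed.

Definition subquot := quotmod submod_in.

HB.instance Definition _ := GRing.Lmodule.on subquot.

End Subquotient.

Section PrettyClean.

Variable R : comNzRingType.

Definition lmod_isomorphic (U V : lmodType R) :=
  exists f : {linear U -> V}, bijective f.

(* The ideals of R are the submodules of R^o; unlike the library's [idealr],
   they are not assumed to be proper. *)
Definition prime_ideal (P : submodClosed R^o) :=
  (1 : R) \notin P /\ prime_idealr_closed (P : {pred R}).

(* The module F i.+1 / F i is isomorphic to R / P i, so the prime written P_i
   in the mathematical definition is P i.-1 here. *)
Definition pretty_clean (M : lmodType R) :=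
  exists (r : nat) (F : nat -> submodClosed M) (P : nat -> submodClosed R^o),
    [/\ F 0 =i pred1 0,
        F r =i predT,
        forall i, (i < r)%N ->
          [/\ {subset F i <= F i.+1}, prime_ideal (P i)
            & lmod_isomorphic (subquot (F i.+1) (F i)) (quotmod (P i))]
      & forall i j, (i < j < r)%N -> {subset P i <= P j} -> P i =i P j].

End PrettyClean.

Section IdealOperations.

Variable R : comNzRingType.

Implicit Types (A J : R -> Prop) (I : {pred R}).

Definition ideal_gen A : R -> Prop := fun f =>
  exists2 s : seq (R * R),
    forall p, p \in s -> A p.2 & f = \sum_(p <- s) p.1 * p.2.

Definition ideal_exp J (k : nat) : R -> Prop :=
  ideal_gen (fun g =>
    exists2 h : 'I_k -> R, forall i, J (h i) & g = \prod_(i < k) h i).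

Definition ideal_colon I J : R -> Prop := fun f =>
  forall g, J g -> f * g \in I.

Definition ideal_sat I J : R -> Prop := fun f =>
  exists2 k : nat, (1 <= k)%N & ideal_colon I (ideal_exp J k) f.

End IdealOperations.

Section BorelType.

Variables (K : fieldType) (n : nat).

Local Notation S := {mpoly K[n]}.

Implicit Type I : {pred S}.

Definition monomial_ideal I :=
  exists G : 'X_{1..n} -> Prop,
    forall f, f \in I <-> ideal_gen (fun g => exists2 m, G m & g = 'X_[m]) f.

Definition var_ideal (j : 'I_n) : S -> Prop := ideal_gen (fun g => g = 'X_j).

Definition initial_var_ideal (j : 'I_n) : S -> Prop :=
  ideal_gen (fun g => exists2 i : 'I_n, (i <= j)%N & g = 'X_i).

Definition borel_type I :=
  monomial_ideal I /\
  forall (j : 'I_n) f,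
    ideal_sat I (var_ideal j) f <-> ideal_sat I (initial_var_ideal j) f.

End BorelType.

(* Main.v *)
(** A monomial ideal is recorded by the up-closed set G of exponents of its
    monomials.  By the Borel condition, for a monomial x^m outside I the indices
    j with x^m in I : x_j^oo form an initial segment {1, ..., d(m)}.  Let D be the
    largest d(m).  Then membership in I does not depend on the variables beyond
    x_D, and multiplying a monomial of
    K[x_1, ..., x_D] with d(m) = D by x_1, ..., x_D as long as it
    stays outside I produces a monomial x^u in K[x_1, ..., x_D] with
    I : x^u = (x_1, ..., x_D).  The ideal I + (x^u) is again of Borel type, with
    largest index at most D.  Iterating, which terminates by Dickson's
    lemma, gives a filtration with cyclic quotients S/(x_1, ..., x_d), d non-increasing. *)
Require Import Defs.
From HB Require Import structures.
From mathcomp Require Import all_boot all_order all_algebra.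
From mathcomp.multinomials Require Import mpoly.
From Stdlib Require Import Classical IndefiniteDescription.
Import GRing.Theory.
Set Implicit Arguments.
Unset Strict Implicit.
Unset Printing Implicit Defensive.
Local Open Scope ring_scope.

(** * Quotient modules and filtrations with cyclic factors *)

Section Modules.

Definition submod_of_closed (R : nzRingType) (V : lmodType R) (p : {pred V})
    (pP : submod_closed p) : submodClosed V :=
  HB.pack p (GRing.isSubmodClosed.Build R V p pP).

(** The isomorphism is built from W to V/N by lifting along g; two lifts differ by an element of the
    kernel N. *)
Lemma first_isomorphism (R : comNzRingType) (V W : lmodType R)
    (N : submodClosed V) (g : {linear V -> W}) :
  (forall w, exists v, g v == w) -> (forall v, (v \in N) = (g v == 0)) ->
  lmod_isomorphic W (quotmod N).
Proof.
move=> gsurj gker; pose h (w : W) : V := xchoose (gsurj w).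
have hK (w : W) : g (h w) = w by apply/eqP/(xchooseP (gsurj w)).
pose f (w : W) : quotmod N := quotmod_pi N (h w).
have fE v w : g v = w -> f w = quotmod_pi N v.
  by move=> gv; apply/eqP; rewrite quotmod_eqE gker linearB /= hK gv subrr.
have fP : linear f.
  move=> a u w; have /fE-> : g (a *: h u + h w) = a *: u + w.
    by rewrite linearD linearZ /= !hK.
  by rewrite linearP.
pose F : {linear W -> quotmod N} := HB.pack f (GRing.isLinear.Build _ _ _ _ f fP).
exists F; exists (fun u => g (repr u)) => [w|u] /=.
  apply/eqP; rewrite -subr_eq0 -{2}(hK w) -raddfB -gker -quotmod_eqE.
  by rewrite quotmod_piK.
by rewrite (fE (repr u)) // quotmod_piK.
Qed.

(** Here N' = N + Rv and P = N : v, so a |-> av maps R onto N'/N with kernel P. *)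
Lemma subquot_cyclic (R : comNzRingType) (V : lmodType R)
    (N' N : submodClosed V) (P : submodClosed R^o) (v : V) :
  v \in N' -> (forall w, w \in N' -> exists a, w - a *: v \in N) ->
  (forall a : R, (a \in P) = (a *: v \in N)) ->
  lmod_isomorphic (subquot N' N) (quotmod P).
Proof.
move=> vN' N'v Pv.
pose x : submod N' := Sub v vN'.
pose g (a : R^o) : subquot N' N := quotmod_pi _ ((a : R) *: x).
have gP : linear g.
  by move=> a u w; rewrite /g scalerDl -scalerA linearP.
pose G : {linear R^o -> subquot N' N} :=
  HB.pack g (GRing.isLinear.Build _ _ _ _ g gP).
have pi0 (y : submod N') :
    (quotmod_pi (@submod_in _ _ N' N) y == 0) = (val y \in N).
  by rewrite -(raddf0 (quotmod_pi _)) quotmod_eqE subr0 submod_inE.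
apply: (@first_isomorphism _ _ _ _ G) => [w|a]; last by rewrite pi0 /= Pv.
have [a aP] := N'v _ (valP (repr w)); exists a.
have -> : (G a == w) = (val (repr w - a *: x) \in N).
  rewrite -[w in LHS]quotmod_piK eq_sym; exact: quotmod_eqE.
exact: aP.
Qed.

Section QuotientSubmodule.

Variables (R : nzRingType) (V : lmodType R) (N N' : submodClosed V).
Hypothesis NN' : {subset N <= N'}.

(** The image N'/N, tested on a chosen representative; [NN'] makes the test independent of the
    choice. *)
Definition quot_submod_pred : {pred quotmod N} := fun x => repr x \in N'.

Lemma quot_submod_predE x : (quotmod_pi N x \in quot_submod_pred) = (x \in N').
Proof.
pose y : V := repr (quotmod_pi N x).
have yx : y - x \in N' by apply: NN'; rewrite -quotmod_eqE quotmod_piK.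
have xy : x - y \in N' by apply: NN'; rewrite -quotmod_eqE quotmod_piK.
apply/idP/idP => [yN|xN]; first by rewrite -(subrK y x) rpredD.
by have := rpredD yx xN; rewrite subrK.
Qed.

Lemma quot_submod_closed : submod_closed quot_submod_pred.
Proof.
split=> [|a x y].
  by rewrite -(raddf0 (quotmod_pi N)) quot_submod_predE rpred0.
rewrite -[x]quotmod_piK -[y]quotmod_piK -linearP !quot_submod_predE => xN yN.
by rewrite rpredD ?rpredZ.
Qed.

Definition quot_submod : submodClosed (quotmod N) :=
  submod_of_closed quot_submod_closed.

Lemma quot_submodE x : (quotmod_pi N x \in quot_submod) = (x \in N').
Proof. exact: quot_submod_predE. Qed.

End QuotientSubmodule.

(** The filtration of V/N is given by its preimages C k in V, so that all conditions can be checked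
    in V. *)
Lemma cyclic_chain_pretty_clean (R : comNzRingType) (V : lmodType R)
    (N : submodClosed V) (r : nat) (C : nat -> submodClosed V) (v : nat -> V)
    (P : nat -> submodClosed R^o) :
    C 0%N =i N -> C r =i predT -> (forall k, {subset N <= C k}) ->
    (forall k, (k < r)%N ->
      [/\ {subset C k <= C k.+1}, v k \in C k.+1,
        forall w, w \in C k.+1 -> exists a, w - a *: v k \in C k,
        prime_ideal (P k)
      & forall a : R, (a \in P k) = (a *: v k \in C k)]) ->
    (forall k l, (k < l < r)%N -> {subset P k <= P l} -> P k =i P l) ->
  pretty_clean (quotmod N).
Proof.
move=> C0 Cr NC Cstep Pinc.
pose F k : submodClosed (quotmod N) := quot_submod (NC k).
have FE k x : (quotmod_pi N x \in F k) = (x \in C k) := quot_submodE (NC k) x.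
exists r, F, P; split=> // [x|x|k kr].
- rewrite -[x]quotmod_piK; transitivity (repr x \in C 0%N); first exact: FE.
  rewrite C0 [RHS]inE -(raddf0 (quotmod_pi N)).
  by rewrite [RHS]quotmod_eqE subr0.
- by rewrite -[x]quotmod_piK; apply: etrans (FE _ _) (Cr _).
- have [CS vS vC Pprime vP] := Cstep k kr; split=> // [x|].
    rewrite -[x]quotmod_piK => xF.
    have /CS xC : repr x \in C k by rewrite -FE.
    by have := FE k.+1 (repr x); rewrite xC.
  apply: (@subquot_cyclic _ _ _ _ _ (quotmod_pi N (v k))) => [|w wF|a].
  + by have := FE k.+1 (v k); rewrite vS.
  + have /vC[a aP] : repr w \in C k.+1 by rewrite -FE quotmod_piK.
    exists a; have := FE k (repr w - a *: v k).
    by rewrite linearB linearZ /= quotmod_piK aP.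
  + by rewrite vP; have := FE k (a *: v k); rewrite linearZ => ->.
Qed.

End Modules.

Lemma addmAC n : right_commutative (@mnm_add n).
Proof. by move=> m1 m2 m3; rewrite -!addmA (addmC m2). Qed.

(** * Dickson's lemma *)

Section Dickson.

Local Open Scope nat_scope.

(** The subsequence runs through indices at which h attains its minimum over the rest of the
    sequence. *)
Lemma nondecreasing_subseq (h : nat -> nat) :
  exists2 g : nat -> nat, {homo g : i j / i < j} &
    forall i j, i <= j -> h (g i) <= h (g j).
Proof.
have tailmin N : exists i, N <= i /\ forall k, i <= k -> h i <= h k.
  have [v] := ubnP (h N); elim: v N => // v IH N hN.
  have [Nmin|/not_all_ex_not[k nk]] :=
    classic (forall k, N <= k -> h N <= h k); first by exists N.
  have [Nk /negP] := imply_to_and _ _ nk; rewrite -ltnNge => hk.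
  have [|i [ki imin]] := IH k.
    exact: leq_trans hk _.
  by exists i; split=> //; apply: leq_trans ki.
have [f fP] := functional_choice _ tailmin.
pose g := fix g i := if i is i'.+1 then f (g i').+1 else f 0.
have gS i : g i < g i.+1 by have [] := fP (g i).+1.
have gmono : {homo g : i j / i < j} by apply: homo_ltn gS; apply: ltn_trans.
exists g => // i j; rewrite leq_eqVlt => /predU1P[-> //|/gmono/ltnW gij].
by case: i gij => [|i] gij; [have [_] := fP 0 | have [_] := fP (g i).+1]; apply.
Qed.

Lemma dickson n (f : nat -> 'X_{1..n}) :
  exists i j, i < j /\ (f i <= f j)%MM.
Proof.
(* Passing to a subsequence once per coordinate makes all coordinates nondecreasing. *)
have [g gmono gf] : exists2 g : nat -> nat, {homo g : i j / i < j} &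
    forall i j, i <= j -> forall c : 'I_n, c \in enum 'I_n ->
      f (g i) c <= f (g j) c.
  elim: (enum _) => [|c s [g gmono gf]]; first by exists id.
  have [g' g'mono g'f] := nondecreasing_subseq (fun i => f (g i) c).
  exists (g \o g') => [i j ij|i j ij c']; first exact/gmono/g'mono.
  rewrite inE => /predU1P[->|]; first exact: g'f.
  by apply: gf; move: ij; rewrite leq_eqVlt => /predU1P[->|/g'mono/ltnW].
exists (g 0), (g 1); split; first exact: gmono.
by apply/mnm_lepP => c; apply: gf; rewrite ?mem_enum.
Qed.

End Dickson.

(** * Up-closed sets of exponents and the Borel condition *)

Section UpSets.

Local Open Scope multi_scope.

Variable n : nat.

Implicit Types (G : pred 'X_{1..n}) (m t u : 'X_{1..n}) (i j : 'I_n).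

Definition up_closed G := forall m t, G m -> G (m + t).

Definition adjoin G u : pred 'X_{1..n} := fun m => G m || (u <= m).

Lemma up_closedW G m t : up_closed G -> G m -> (m <= t) -> G t.
Proof. by move=> Gup Gm mt; rewrite -(submK mt) addmC; apply: Gup. Qed.

Lemma adjoin_up_closed G u : up_closed G -> up_closed (adjoin G u).
Proof.
move=> Gup m t /orP[Gm|um]; apply/orP; [by left; apply: Gup|right].
exact/(lepm_trans um)/lem_addr.
Qed.

(** Noetherian induction for monomial ideals. A counterexample yields an infinite sequence of
    adjoined u_k, each outside the set reached so far; Dickson's lemma gives k < l with u_k <= u_l,
    so u_l was already inside. *)
Lemma adjoin_ind (P : pred 'X_{1..n} -> Prop) :
  (forall G, up_closed G -> (forall u, ~~ G u -> P (adjoin G u)) -> P G) ->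
  forall G, up_closed G -> P G.
Proof.
move=> Pstep G0 G0up; apply: NNPP => nPG0.
pose T := {G | up_closed G /\ ~ P G}.
have next (G : T) : exists u, ~~ sval G u /\ ~ P (adjoin (sval G) u).
  case: G => G [Gup nPG] /=; apply: NNPP => nex; apply/nPG/Pstep => // u Gu.
  by apply: NNPP => nP; apply: nex; exists u.
have [u uP] := functional_choice _ next.
pose step (G : T) : T := exist _ (adjoin (sval G) (u G))
  (conj (@adjoin_up_closed _ (u G) (proj1 (svalP G))) (proj2 (uP G))).
pose F k := iter k step (exist _ G0 (conj G0up nPG0)).
have Fmono k l m : (k <= l)%N -> sval (F k) m -> sval (F l) m.
  move/subnK <-; elim: (l - k)%N => //= d IH /IH Fm.
  by rewrite /adjoin Fm.
have [k [l [kl ukl]]] := dickson (fun k => u (F k)).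
have [/negP[]] := uP (F l); apply: Fmono kl _.
by rewrite /= /adjoin ukl orbT.
Qed.

(* [eventually G m j] says that x^m lies in I : x_j^oo. *)
Definition eventually G m j := exists k, G (m + U_(j) *+ k).

Definition borel_set G :=
  forall m i j, (i <= j)%N -> eventually G m j -> eventually G m i.

(* Variables are numbered from 0 by 'I_n, so the bound D is the 1-based index of
   the last variable allowed. *)
Definition var_bounded G D :=
  forall m j, ~~ G m -> eventually G m j -> (j < D)%N.

(* I is extended from K[x_1, ..., x_D]. *)
Lemma var_bounded_strip G D m t :
  var_bounded G D -> (forall j, (j < D)%N -> t j = 0%N) -> G (m + t) -> G m.
Proof.
move=> GD tD; rewrite (multinomUE_id t).
elim/big_rec: _ => [|j s _ IH]; first by rewrite addm0.
rewrite (addmC (_ *+ _)) addmA => Gms; apply: IH.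
have [jD|Dj] := ltnP j D; first by rewrite tD // mulm0n addm0 in Gms.
apply/negPn/negP => nG; suff: (j < D)%N by rewrite ltnNge Dj.
by apply: GD nG _; exists (t j).
Qed.

Lemma exists_corner G D m :
    up_closed G -> var_bounded G D -> ~~ G m ->
    (forall j, (j < D)%N -> eventually G m j) ->
  exists u, [/\ ~~ G u, forall j, (j < D)%N -> G (u + U_(j))
    & forall j, (D <= j)%N -> u j = 0%N].
Proof.
move=> Gup GD nGm mD.
(* Only m1 is kept: it stays outside G since G is up-closed, and [var_bounded_strip] turns
   [eventually G m j] into [eventually G m1 j] for j < D. *)
pose m1 : 'X_{1..n} := [multinom (if (j < D)%N then m j else 0%N) | j < n].
pose m2 : 'X_{1..n} := [multinom (if (j < D)%N then 0%N else m j) | j < n].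
have mE : m = m1 + m2.
  by apply/mnmP=> j; rewrite mnmDE !mnmE; case: ifP; rewrite ?addn0.
have m2D j : (j < D)%N -> m2 j = 0%N by rewrite mnmE => ->.
(* Invariant: the exponents of the first min(e, D) variables are already maximal. *)
suff /(_ D): forall e, exists u, [/\ ~~ G u,
    forall j, (j < D)%N -> eventually G u j,
    forall j, (j < minn e D)%N -> G (u + U_(j))
    & forall j, (D <= j)%N -> u j = 0%N].
  by rewrite minnn => -[u [? _ ? ?]]; exists u.
elim=> [|e [u [nGu uD ue u0]]].
  exists m1; split=> [|j jD|j|j]; last 2 first.
  - by rewrite min0n.
  - by rewrite mnmE ltnNge => ->.
  - by apply: contra nGm => Gm; rewrite mE; apply: Gup.
  have [k Gk] := mD j jD; exists k; apply: var_bounded_strip GD m2D _.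
  by rewrite addmAC -mE.
have [De|eD] := leqP D e.
  exists u; split=> // j; rewrite (minn_idPr _) ?(leq_trans De) // => jD.
  by apply: ue; rewrite (minn_idPr De).
have [ne|en] := leqP n e.
  exists u; split=> // j _; apply: ue.
  rewrite leq_min !(leq_trans (ltn_ord j)) //.
  exact: ltnW (leq_ltn_trans ne eD).
pose c := Ordinal en.
(* The least power of the variable c that leads into G is positive, as u is outside G; one power
   less stays outside. *)
case: (ex_minnP (uD c eD)) => -[|k]; first by rewrite mulm0n addm0 (negPf nGu).
move=> Gk kmin; exists (u + U_(c) *+ k); split=> [|j jD|j|j Dj].
- by apply/negP => /kmin; rewrite ltnn.
- by have [l Gl] := uD j jD; exists l; rewrite addmAC; apply: Gup.
- rewrite (minn_idPl _) // ltnS leq_eqVlt => /predU1P[jc|je].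
    by rewrite -addmA -[in X in _ + X](_ : c = j) -?mulmSr //; apply: val_inj.
  by rewrite addmAC; apply/Gup/ue; rewrite leq_min je (ltn_trans je).
- rewrite mnmDE u0 // mulmnE mnm1E; case: eqP => // cj.
  by move: Dj; rewrite -cj leqNgt eD.
Qed.

(** If t involves one of the first D variables, x^(u+t) is a multiple of some x^u x_j in I;
    otherwise [var_bounded_strip] would put u in G. *)
Lemma corner_colon G D u t :
    up_closed G -> var_bounded G D -> ~~ G u ->
    (forall j, (j < D)%N -> G (u + U_(j))) ->
  G (u + t) = [exists j : 'I_n, (j < D)%N && (t j != 0%N)].
Proof.
move=> Gup GD nGu uD; apply/idP/existsP => [Gut|[j /andP[jD tj]]].
  apply/existsP; apply: contraNT nGu; rewrite negb_exists => /forallP tD.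
  apply: var_bounded_strip GD _ Gut => j jD.
  by have := tD j; rewrite jD /= negbK => /eqP.
apply: up_closedW Gup (uD j jD) _; apply/mnm_lepP => i.
rewrite !mnmDE leq_add2l mnm1E; case: eqP => // <-; by rewrite lt0n.
Qed.

Lemma not_le_add u m j k :
  ~~ (u <= m) -> u <= m + U_(j) *+ k -> (u j != 0)%N.
Proof.
move=> /mnm_lepP num /mnm_lepP umk; apply/eqP => uj; apply: num => i.
have := umk i; rewrite mnmDE mulmnE mnm1E; case: eqP => [<-|_].
  by rewrite uj.
by rewrite mul0n addn0.
Qed.

Section AdjoinCorner.

Variables (G : pred 'X_{1..n}) (D : nat) (u : 'X_{1..n}).
Hypotheses (Gup : up_closed G) (uD : forall j, (j < D)%N -> G (u + U_(j))).
Hypothesis u0 : forall j, (D <= j)%N -> u j = 0%N.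

(** Multiplying by powers of x_j can create divisibility by x^u only if x_j divides x^u. *)
Lemma adjoin_corner_ltn m j k :
  ~~ (u <= m) -> u <= m + U_(j) *+ k -> (j < D)%N.
Proof.
move=> num umk; rewrite ltnNge; apply/negP => /u0 uj.
by have := not_le_add num umk; rewrite uj.
Qed.

(** If x^u newly divides x^m x_j^k, then x_j x^u in I puts x^m x_j^(k+1) in I, and the Borel
    property of G applies. *)
Lemma adjoin_corner_borel : borel_set G -> borel_set (adjoin G u).
Proof.
move=> Gb m i j ij [k] Gmk.
have [um|num] := boolP (u <= m).
  by exists 0%N; rewrite mulm0n addm0 /adjoin um orbT.
have [l Gl] : eventually G m i.
  apply: Gb ij _; case/orP: Gmk => [Gmk|umk]; first by exists k.
  exists k.+1; rewrite mulmSr addmA.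
  apply: up_closedW Gup (uD (adjoin_corner_ltn num umk)) _.
  apply/mnm_lepP => c; rewrite !mnmDE leq_add2r.
  by have /mnm_lepP/(_ c) := umk; rewrite mnmDE.
by exists l; rewrite /adjoin Gl.
Qed.

Lemma adjoin_corner_bounded : var_bounded G D -> var_bounded (adjoin G u) D.
Proof.
move=> GD m j; rewrite negb_or => /andP[nGm num] [k /orP[Gmk|umk]].
  by apply: GD nGm _; exists k.
exact: adjoin_corner_ltn num umk.
Qed.

End AdjoinCorner.

(* The exponents of the monomials in I = I_0 <= ... <= I_r = S, where
   I_{k+1} = I_k + (x^{u k}) and I_k : x^{u k} is generated by the first d k
   variables. *)
Definition clean_chain G D :=
  exists (r : nat) (F : nat -> pred 'X_{1..n}) (u : nat -> 'X_{1..n})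
      (d : nat -> nat),
    [/\ F 0%N = G /\ (forall m, F r m),
        forall k, up_closed (F k) /\ (forall m, G m -> F k m),
        forall k, (k < r)%N -> F k.+1 = adjoin (F k) (u k) /\
          forall t, F k (u k + t) =
            [exists j : 'I_n, (j < d k)%N && (t j != 0%N)]
      & (forall k, d k <= D)%N /\
          forall k l, (k < l < r)%N -> (d l <= d k)%N].

(** The corner u obtained from m is adjoined, and G is put in front of the resulting chain with
    first index D; the bound D on the later indices keeps the sequence non-increasing. *)
Lemma clean_chain_adjoin G D m :
    up_closed G ->
    (forall u, ~~ G u -> forall D, borel_set (adjoin G u) ->
       var_bounded (adjoin G u) D -> clean_chain (adjoin G u) D) ->
    borel_set G -> var_bounded G D ->
    ~~ G m -> (forall j, (j < D)%N -> eventually G m j) ->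
  clean_chain G D.
Proof.
move=> Gup IH Gb GD nGm mD.
have [u [nGu uD u0]] := exists_corner Gup GD nGm mD.
have [r [F [us [d [[F0 Fr] Fup Fstep [dD dmono]]]]]] := IH u nGu D
  (adjoin_corner_borel Gup uD u0 Gb) (adjoin_corner_bounded u0 GD).
exists r.+1, (fun k => if k is k'.+1 then F k' else G),
  (fun k => if k is k'.+1 then us k' else u),
  (fun k => if k is k'.+1 then d k' else D).
split=> //; first 1 last.
- case=> [_|k kr]; last exact: Fstep.
  by split=> // t; apply: corner_colon.
- by split=> [[|k]|[|k] [|l] //= kl] //; apply: dmono.
- case=> [|k] //; have [Fkup FkG] := Fup k.
  by split=> // t Gt; apply: FkG; rewrite /adjoin Gt.
Qed.

(** The outer induction enlarges G, the inner one lowers D until some m outside G attains it. *)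
Lemma borel_clean_chain G :
  up_closed G -> forall D, borel_set G -> var_bounded G D -> clean_chain G D.
Proof.
move=> Gup; move: G Gup; apply: adjoin_ind => G Gup IH D Gb.
have [Gfull|/not_all_ex_not[m0 /negP nGm0]] := classic (forall m, G m).
  move=> _; exists 0%N, (fun=> G), (fun=> 0), (fun=> 0%N).
  by split; split=> //; case.
elim: D => [|D IHD] GD.
  (* For D = 0 the condition on the variables is vacuous, so any m0 outside G will do. *)
  exact: (clean_chain_adjoin (m := m0)).
have [[m [nGm mD]]|noD] := classic (exists m, ~~ G m /\
    forall j, (j < D.+1)%N -> eventually G m j).
  exact: (clean_chain_adjoin (m := m)).
have [|r [F [u [d [F1 F2 F3 [dD dmono]]]]]] := IHD.
  (* If j = D, the Borel condition gives m all indices up to D, which [noD] excludes. *)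
  move=> m j nGm mj; rewrite ltn_neqAle -ltnS (GD m j nGm mj) andbT.
  apply/eqP => jD; apply: noD; exists m; split=> // i.
  by rewrite ltnS -jD => ij; apply: Gb ij mj.
by exists r, F, u, d; split=> //; split=> // k; apply: leqW.
Qed.

End UpSets.

(** * From exponent sets back to monomial ideals *)

Section MonomialIdeals.

Variables (K : fieldType) (n : nat).

Local Notation S := {mpoly K[n]}.

Implicit Types (G : pred 'X_{1..n}) (f g : S) (m u t : 'X_{1..n}) (d : nat).

Definition monoms_in G : {pred S^o} := fun f => all G (msupp (f : S)).

Lemma monoms_inP G f :
  reflect (forall m, f@_m != 0 -> G m) (f \in monoms_in G).
Proof.
apply: (iffP allP) => Gf m; first by rewrite -mcoeff_msupp; apply: Gf.
by rewrite mcoeff_msupp; apply: Gf.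
Qed.

Lemma monoms_in_closed G : up_closed G -> submod_closed (monoms_in G).
Proof.
move=> Gup; split=> [|a f g /allP Gf /allP Gg].
  by rewrite /in_mem /= /monoms_in msupp0.
apply/allP => m /msuppD_le; rewrite mem_cat.
case/orP=> [/msuppM_le|]; last exact: Gg.
by case/allpairsP => -[m1 m2] /= [_ /Gf Gm2 ->]; rewrite addmC; apply: Gup.
Qed.

Definition monom_ideal G (Gup : up_closed G) : submodClosed S^o :=
  submod_of_closed (monoms_in_closed Gup).

Lemma monom_idealE G (Gup : up_closed G) f :
  (f \in monom_ideal Gup) = (f \in monoms_in G).
Proof. by []. Qed.

Lemma mpolyX_in G m : ('X_[K, m] \in monoms_in G) = G m.
Proof. by rewrite /in_mem /= /monoms_in msuppX /= andbT. Qed.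

Lemma mulX_in G f u :
  (f * 'X_[u] \in monoms_in G) = (f \in monoms_in (fun t => G (u + t)%MM)).
Proof. by rewrite /in_mem /= /monoms_in (perm_all _ (msuppMX _ _)) all_map. Qed.

(** The terms of f outside G are all divisible by x^u; a is their sum divided by x^u. *)
Lemma adjoin_remainder G u f :
  f \in monoms_in (adjoin G u) -> exists a, f - a * 'X_[u] \in monoms_in G.
Proof.
move=> /allP Gf.
exists (\sum_(m <- msupp f | ~~ G m) f@_m *: 'X_[m - u]).
rewrite {1}(mpolyE f) (bigID G) /= mulr_suml.
rewrite [X in _ + X - _](_ : _ =
  \sum_(m <- msupp f | ~~ G m) f@_m *: 'X_[m - u] * 'X_[u]); last first.
  rewrite big_seq_cond [RHS]big_seq_cond; apply: eq_bigr => m /andP[/Gf].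
  by case/orP=> [->//|um _]; rewrite -scalerAl -mpolyXD submK.
rewrite addrK; apply/monoms_inP => m; apply: contraNT => nGm.
rewrite raddf_sum big1 // => t Gt; rewrite /= mcoeffZ mcoeffX.
by case: eqP => [tm|_]; rewrite ?mulr0 //; rewrite -tm Gt in nGm.
Qed.

(** The exponents of the monomials in (x_1, ..., x_d). *)
Definition touches d : pred 'X_{1..n} :=
  fun t => [exists j : 'I_n, (j < d)%N && (t j != 0%N)].

Lemma touches_up_closed d : up_closed (touches d).
Proof.
move=> m t /existsP[j /andP[jd mj]]; apply/existsP; exists j.
by rewrite jd mnmDE addn_eq0 negb_and mj.
Qed.

Definition kill_vars d : n.-tuple S :=
  [tuple if (i < d)%N then 0 else 'X_i | i < n].

Lemma kill_varsX d m :
  'X_[m] \mPo kill_vars d = if touches d m then 0 else 'X_[m].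
Proof.
rewrite comp_mpolyX; case: ifPn => [/existsP[j /andP[jd mj]]|nm].
  by rewrite (bigD1 j) //= tnth_mktuple jd expr0n (negPf mj) mul0r.
rewrite [in RHS]mpolyXE_id; apply: eq_bigr => i _; rewrite tnth_mktuple.
move: nm; rewrite negb_exists => /forallP/(_ i); case: ifP => //= _.
by rewrite negbK => /eqP->; rewrite !expr0.
Qed.

(* The ideal of the first d variables is the kernel of a ring morphism into a
   domain, hence prime. *)
Lemma kill_vars_eq0 d f :
  (f \mPo kill_vars d == 0) = (f \in monoms_in (touches d)).
Proof.
have coefE m : (f \mPo kill_vars d)@_m = if touches d m then 0 else f@_m.
  rewrite comp_mpolyEX raddf_sum.
  under eq_bigr => t _ do rewrite /= mcoeffZ kill_varsX.
  case: ifPn => nm.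
    rewrite big1 // => t _; case: ifPn => nt; first by rewrite mcoeff0 mulr0.
    by rewrite mcoeffX; case: eqP nt => [->|]; rewrite ?nm ?mulr0.
  rewrite [RHS](congr1 (mcoeff m) (mpolyE f)) raddf_sum; apply: eq_bigr => t _.
  rewrite /= mcoeffZ; case: ifPn => // nt; rewrite mcoeff0 mcoeffX.
  by case: eqP nt nm => // -> ->.
apply/eqP/monoms_inP => [f0 m|fd].
  by have := coefE m; rewrite f0 mcoeff0; case: ifP => // _ <-; rewrite eqxx.
apply/mpolyP => m; rewrite coefE mcoeff0; case: ifPn => //.
by apply: contraNeq; apply: fd.
Qed.

Lemma touches_prime d : prime_ideal (monom_ideal (@touches_up_closed d)).
Proof.
split=> [|f g].
  rewrite -mpolyX0 mpolyX_in; apply/existsP => -[j].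
  by rewrite mnm0E eqxx andbF.
by rewrite -!kill_vars_eq0 rmorphM mulf_eq0.
Qed.

Lemma clean_chain_pretty_clean (I : submodClosed S^o) G D :
    (forall f, (f \in I) = (f \in monoms_in G)) -> clean_chain G D ->
  pretty_clean (quotmod I).
Proof.
move=> IG [r [F [u [d [[F0 Fr] FP Fstep [_ dmono]]]]]].
have Fup k : up_closed (F k) by have [] := FP k.
have sIF k : {subset I <= monom_ideal (Fup k)}.
  move=> f; rewrite IG => /allP Gf; apply/allP => m /Gf.
  by have [_] := FP k; apply.
apply: (@cyclic_chain_pretty_clean _ _ I r (fun k => monom_ideal (Fup k))
  (fun k => 'X_[u k]) (fun k => monom_ideal (@touches_up_closed (d k)))) => //.
- by move=> f; rewrite IG -F0.
- by move=> f; apply/allP => m _; apply: Fr.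
- move=> k kr; have [FS colon] := Fstep k kr; split.
  + move=> f /allP Ff; rewrite monom_idealE FS.
    by apply/allP => m /Ff; rewrite /adjoin => ->.
  + by rewrite monom_idealE mpolyX_in FS /adjoin lepm_refl orbT.
  + by move=> f; rewrite monom_idealE FS => /adjoin_remainder.
  + exact: touches_prime.
  + by move=> f; rewrite [RHS]mulX_in; apply: eq_all.
(* As d l <= d k, the l-th prime lies in the k-th, so the inclusion [sub] is an equality. *)
move=> k l kl sub f; apply/idP/idP; first exact: sub.
move=> /allP fl; apply/allP => m /fl /existsP[j /andP[jd mj]].
by apply/existsP; exists j; rewrite mj (leq_trans jd) // dmono.
Qed.

Lemma monomial_idealE (I : submodClosed S^o) :
    monomial_ideal (I : {pred S}) ->
  forall f, (f \in I) = (f \in monoms_in (fun m => 'X_[m] \in I)).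
Proof.
move=> [B BP] f.
have mulI (a b : S) : b \in I -> a * b \in I by apply: rpredZ.
apply/idP/allP => [fI m|If]; last first.
  rewrite (mpolyE f) big_seq; apply: rpred_sum => m /If mI.
  by rewrite -mul_mpolyC; apply: mulI.
have [s sB ->] := (BP f).1 fI.
(* Each monomial of f occurs in some product p.1 * p.2, hence is a multiple of a generator x^g. *)
move/msupp_sum_le/flattenP => [ms /mapP[p]]; rewrite filter_predT.
move=> /sB[g Bg ->] ->; rewrite (perm_mem (msuppMX _ _)) => /mapP[t _ ->].
rewrite addmC mpolyXD; apply/mulI/BP; exists [:: (1, 'X_[g])].
  by move=> q; rewrite inE => /eqP->; exists g.
by rewrite big_seq1 mul1r.
Qed.

Lemma ideal_sat_varP (I : submodClosed S^o) j f k :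
  f * 'X_j ^+ k \in I -> ideal_sat (I : {pred S}) (var_ideal j) f.
Proof.
(* A product of k + 1 elements of (x_j) is a multiple of x_j^(k+1); using k + 1 keeps the exponent
   positive, as [ideal_sat] demands. *)
move=> fI; exists k.+1 => // _ [s sP ->]; rewrite mulr_sumr.
have mulI (a b : S) : b \in I -> a * b \in I by apply: rpredZ.
rewrite big_seq; apply: rpred_sum => p /sP[h hP ->].
rewrite mulrCA; apply: (mulI).
have hX i : exists c, h i = c * 'X_j.
  have [t tX ->] := hP i; exists (\sum_(q <- t) q.1).
  by rewrite mulr_suml big_seq [RHS]big_seq; apply: eq_bigr => q /tX->.
have [c ->] : exists c, \prod_(i < k.+1) h i = c * 'X_j ^+ k.+1.
  elim: k.+1 h hX {hP fI} => [|l IH] h hX.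
    by exists 1; rewrite big_ord0 expr0 mulr1.
  have [c hc] := hX ord0; have [|b bE] := IH (fun i => h (lift ord0 i)).
    by move=> i; apply: hX.
  by exists (c * b); rewrite big_ord_recl hc bE mulrACA exprS.
by rewrite mulrCA exprS (mulrCA f); do 2!apply: (mulI).
Qed.

Lemma borel_type_set (I : submodClosed S^o) :
  borel_type (I : {pred S}) -> borel_set (fun m => 'X_[K, m] \in I).
Proof.
move=> [_ Ib] m i j ij [k]; rewrite mpolyXD -mpolyXn => /ideal_sat_varP/Ib.
(* The saturation is tested on x_i^l, which lies in the l-th power of (x_1, ..., x_j) since i <=
   j. *)
case=> l _ /(_ ('X_i ^+ l)) Il; exists l; rewrite mpolyXD -mpolyXn; apply: Il.
exists [:: (1, 'X_i ^+ l)]; last by rewrite big_seq1 mul1r.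
move=> p; rewrite inE => /eqP->; exists (fun=> 'X_i); last first.
  by rewrite prodr_const card_ord.
move=> _; exists [:: (1, 'X_i)]; last by rewrite big_seq1 mul1r.
by move=> q; rewrite inE => /eqP->; exists i.
Qed.

End MonomialIdeals.

Unset Implicit Arguments.

Theorem proposition5p2 (K : fieldType) (n : nat)
    (I : submodClosed ({mpoly K[n]})^o) :
  borel_type (I : {pred {mpoly K[n]}}) -> pretty_clean (quotmod I).
Proof.
move=> Ib; have [Imon _] := Ib.
apply: (clean_chain_pretty_clean (D := n) (monomial_idealE Imon)).
apply: borel_clean_chain => [m t mI||m j _ _]; last exact: ltn_ord.
  by rewrite addmC mpolyXD; apply: (rpredZ ('X_[t] : {mpoly K[n]})) mI.
exact: borel_type_set.
Qed.
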